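(* Let $\mathcal{D}=\bigcup_{(a,b)}\mathcal{D}(a,b)$, the union over all pairs of relatively prime positive integers $a>b$. Then $\sup\{L(\omega):\omega\in\mathcal{D}\}=1+\sqrt5$.
   Context: A lattice path from $(0,0)$ to $(a,b)$ is a word $w_1\cdots w_{a+b}$ in the letters $R$ (unit step right) and $U$ (unit step up) with $a$ letters $R$ and $b$ letters $U$; $\mathcal{D}(a,b)$ is the set of such paths lying (weakly) below the line $y=\frac bax$. For a word $W=w_1\cdots w_n$, $f(W)=[a_0,\ldots,a_t]$ is the finite continued fraction whose entry sequence is obtained by scanning $i=1,\ldots,n-1$ and appending $1,1$ if $w_i=w_{i+1}$ and $2$ if $w_i\ne w_{i+1}$. Then $g(\omega)=[\overline{2,a_0,\ldots,a_t}]$ is the purely periodic infinite continued fraction with period $(2,a_0,\ldots,a_t)$. For irrational $\alpha$, $L(\alpha)=\sup\{L: |\frac pq-\alpha|<\frac1{Lq^2}\text{ for infinitely many reduced }\frac pq\}$, and $L(\omega):=L(g(\omega))$. *)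

(* Defs.v *)
From HB Require Import structures.
From mathcomp Require Import all_boot all_order all_algebra.
From mathcomp Require Import all_classical all_reals all_analysis.
Set Implicit Arguments.
Unset Strict Implicit.
Unset Printing Implicit Defensive.
Import Order.TTheory GRing.Theory Num.Theory.
Import numFieldNormedType.Exports.
Local Open Scope classical_set_scope.
Local Open Scope ring_scope.

Inductive step := StepR | StepU.

Definition bool_of_step (s : step) : bool := if s is StepR then true else false.
Definition step_of_bool (b : bool) : step := if b then StepR else StepU.

Lemma bool_of_stepK : cancel bool_of_step step_of_bool.
Proof. by case. Qed.

HB.instance Definition _ := Countable.copy step (can_type bool_of_stepK).

(* A path weakly below a line is tested at its vertices only, which suffices
   because its steps are line segments; the vertex reached after [k] steps is
   (number of R's, number of U's) in [take k w]. *)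
Definition paths_below (a b : nat) : set (seq step) :=
  [set w | [/\ count_mem StepR w = a, count_mem StepU w = b &
     forall k, (k <= size w)%N ->
       (count_mem StepU (take k w))%:R
         <= b%:R / a%:R * (count_mem StepR (take k w))%:R :> rat]].

Definition all_paths : set (seq step) :=
  \bigcup_(ab in [set ab : nat * nat |
      [/\ coprime ab.1 ab.2, (0 < ab.2)%N & (ab.2 < ab.1)%N]])
    paths_below ab.1 ab.2.

Fixpoint word_cf (w : seq step) : seq nat :=
  match w with
  | x :: ((y :: _) as w') =>
      (if x == y then [:: 1%N; 1%N] else [:: 2%N]) ++ word_cf w'
  | _ => [::]
  end.

(* The value on the empty sequence is junk. *)
Fixpoint finite_cf (R : realType) (s : seq nat) : R :=
  match s with
  | [::] => 0
  | [:: a] => a%:R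
  | a :: s' => a%:R + 1 / finite_cf R s'
  end.

Definition infinite_cf (R : realType) (u : nat -> nat) : R :=
  lim ((fun n : nat => finite_cf R (mkseq u n.+1)) @ \oo).

Definition periodic_cf (R : realType) (p : seq nat) : R :=
  infinite_cf R (fun n => nth 0%N p (n %% size p)).

Definition path_cf (R : realType) (w : seq step) : R :=
  periodic_cf R (2%N :: word_cf w).

(* Elements of [rat] are in bijection with reduced fractions p/q, q > 0, the
   denominator being [denq]. Nonpositive [L] never satisfy the condition
   (in particular 1 / 0 = 0). The supremum is taken in the extended reals,
   since it is infinite for Liouville numbers. *)
Definition lagrange (R : realType) (alpha : R) : \bar R :=
  ereal_sup [set L%:E | L in [set L : R |
    infinite_set [set r : rat |
      `|ratr r - alpha| < 1 / (L * (denq r)%:~R ^+ 2)]]].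

Definition path_lagrange (R : realType) (w : seq step) : \bar R :=
  lagrange (path_cf R w).

(* Main.v *)
Require Import Defs.
From mathcomp Require Import all_boot all_order all_algebra.
From mathcomp Require Import all_classical all_reals all_analysis.
From mathcomp Require Import zify ring lra.
Import Order.TTheory GRing.Theory Num.Theory.
Import numFieldNormedType.Exports.
Local Open Scope classical_set_scope.
Local Open Scope ring_scope.

(* Write alpha = [2; a_0, a_1, ...], A_k = [a_k; a_(k+1), ...] and
   x_k = [0; a_(k-1), ..., a_0]. The convergents approximate alpha with
   |alpha - p/q| = 1 / ((A_k + x_k) q^2), and an infinite descent on indefinite
   binary forms shows that if A_k + x_k <= M for all k (with M >= 2) then
   |alpha - p/q| >= 1 / (M q^2) for every rational p/q.
   For the period of a path all runs of 1's between consecutive 2's have even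
   length. Let g = (sqrt 5 - 1) / 2 be the fixed point of the increasing
   contraction x |-> [0; 1, 1 + x]. Next to a digit 2 both
   [0; a_(k+1), ...] and x_k are images under iterates of this map of a number
   at most g, so A_k + x_k <= 2 + 2g = 1 + sqrt 5. Conversely the paths
   R^(n+2) U^(n+1) contain a digit 2 between two runs of 1's of length at least
   2n, for which A_k + x_k tends to 2 + 2g. *)

(** * Convergence of continued fractions with digits 1 and 2 *)

Definition digits12 (a : nat -> nat) := forall k, (a k == 1%N) || (a k == 2%N).

Lemma digits12_bounds (R : realType) (a : nat -> nat) (k : nat) :
  digits12 a -> (1 <= (a k)%:R :> R) && ((a k)%:R <= 2 :> R).
Proof. by move=> /(_ k) /orP[] /eqP ->; apply/andP; split; rewrite ?ler1n ?ler_nat. Qed.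

Lemma finite_cf_shift (R : realType) (a : nat -> nat) (n : nat) :
  finite_cf R (mkseq a n.+2) =
  (a 0%N)%:R + (finite_cf R (mkseq (fun j => a j.+1) n.+1))^-1.
Proof.
have -> : mkseq a n.+2 = a 0%N :: mkseq (fun j => a j.+1) n.+1.
  by rewrite /mkseq -[iota 0 n.+2]/(0%N :: iota (1 + 0) n.+1) iotaDl map_cons -map_comp.
by rewrite -[(_ ^-1)]div1r.
Qed.

Lemma finite_cf_bounds (R : realType) (a : nat -> nat) (n : nat) :
  digits12 a -> 1 <= finite_cf R (mkseq a n.+1) <= 3.
Proof.
elim: n a => [|n IH] a da.
  by have /= /andP[? ?] := digits12_bounds R a 0 da; apply/andP; split; lra.
rewrite finite_cf_shift.
have /IH /andP[lo hi] : digits12 (fun j => a j.+1) by move=> j; exact: da.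
have /andP[? ?] := digits12_bounds R a 0 da.
set x := finite_cf _ _ in lo hi *.
have x0 : 0 < x by lra.
have : 0 < x^-1 by rewrite invr_gt0.
have : x^-1 <= 1 by rewrite invf_le1.
by move=> ? ?; apply/andP; split; lra.
Qed.

(** Removing a common first digit divides the distance by the product of the two remaining
    fractions. Once each has at least two digits, both are at least 1 + 1/3, so the product is at
    least 16/9, more than the ratio of consecutive bounds. The true decay is geometric; a harmonic
    bound suffices for the Cauchy criterion. *)
Lemma finite_cf_dist (R : realType) (a : nat -> nat) (k m n : nat) :
  digits12 a ->
  `|finite_cf R (mkseq a (n + k.+1)) - finite_cf R (mkseq a (m + k.+1))|
    <= 4 / k.+2%:R.
Proof.
elim: k a m n => [|k IH] a m n da.
  rewrite !addn1.
  have /andP[? ?] := finite_cf_bounds R a n da.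
  have /andP[? ?] := finite_cf_bounds R a m da.
  by rewrite ler_norml; apply/andP; split; lra.
case: k IH => [|k] IH.
  rewrite !addn2.
  have /andP[? ?] := finite_cf_bounds R a n.+1 da.
  have /andP[? ?] := finite_cf_bounds R a m.+1 da.
  rewrite !finite_cf_shift.
  have da' : digits12 (fun j => a j.+1) by move=> j; exact: da.
  have inv_bounds (x : R) : 1 <= x <= 3 -> 1 / 3 <= x^-1 <= 1.
    move=> /andP[lo hi]; apply/andP; split; last by rewrite invf_le1//; lra.
    by rewrite div1r lef_pV2// posrE; lra.
  have /inv_bounds/andP[? ?] := finite_cf_bounds R _ n da'.
  have /inv_bounds/andP[? ?] := finite_cf_bounds R _ m da'.
  by rewrite ler_norml; apply/andP; split; lra.
have da' : digits12 (fun j => a j.+1) by move=> j; exact: da.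
have := IH _ m n da'.
rewrite !addnS !(finite_cf_shift R a).
set u := finite_cf _ _; set v := finite_cf _ _ => uv.
have low (j : nat) : 4 / 3 <= finite_cf R (mkseq (fun i => a i.+1) j.+2).
  rewrite finite_cf_shift.
  have da'' : digits12 (fun j => a j.+2) by move=> i; exact: da.
  have /andP[lo hi] := finite_cf_bounds R _ j da''.
  have /andP[? ?] := digits12_bounds R a 1 da.
  suff : 3^-1 <= (finite_cf R (mkseq (fun j0 => a j0.+2) j.+1))^-1 by lra.
  by rewrite lef_pV2// posrE; lra.
have u43 : 4 / 3 <= u := low _.
have v43 : 4 / 3 <= v := low _.
have -> : (a 0%N)%:R + u^-1 - ((a 0%N)%:R + v^-1) = (v - u) / (u * v).
  by field; apply/andP; split; lra.
have uv0 : 16 / 9 <= u * v by nra.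
rewrite normrM distrC normfV (@ger0_norm _ (u * v)); last by lra.
rewrite ler_pdivrMr; last by lra.
apply: (le_trans uv).
have -> : 4 / k.+4%:R * (u * v) = (4 * (u * v)) / k.+4%:R :> R by ring.
rewrite ler_pdivrMr ?ltr0n// mulrAC ler_pdivlMr ?ltr0n//.
have k0 : 0 <= k%:R :> R by rewrite ler0n.
rewrite -[k.+4]addn4 -[k.+3]addn3 !natrD.
have : (k%:R + 3) * (16 / 9) <= (k%:R + 3) * (u * v) by rewrite ler_pM2l//; lra.
by lra.
Qed.

Lemma is_cvg_finite_cf (R : realType) (a : nat -> nat) :
  digits12 a -> cvgn (fun n => finite_cf R (mkseq a n.+1)).
Proof.
move=> da; apply: cauchy_cvg; apply: cauchy_exP => e e0.
have [k ke] : exists k, 0 + k.+1%:R^-1 < e / 4 by apply: ltr_add_invr; lra.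
exists (finite_cf R (mkseq a (0 + k.+1))).
suff : \forall n \near \oo,
  ball (finite_cf R (mkseq a (0 + k.+1))) e (finite_cf R (mkseq a n.+1)) by [].
near=> n.
have -> : n.+1 = ((n - k) + k.+1)%N.
  have : (k <= n)%N by near: n; exact: nbhs_infty_ge.
  by move=> kn; rewrite addnS subnK.
rewrite -ball_normE; apply: le_lt_trans (finite_cf_dist R a k (n - k) 0 da) _.
apply: (@le_lt_trans _ _ (4 * k.+1%:R^-1)); last first.
  by rewrite mulrC -ltr_pdivlMr// -[_^-1]add0r.
by rewrite ler_pM2l// lef_pV2 ?posrE ?ltr0n// ler_nat.
Unshelve. all: by end_near. Qed.

(** * Complete quotients and the upper bound for the Lagrange value *)

Definition cf_tail (R : realType) (a : nat -> nat) (k : nat) : R :=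
  infinite_cf R (fun n => a (k + n)%N).

Lemma cf_tail_bounds (R : realType) (a : nat -> nat) (k : nat) :
  digits12 a -> 1 <= cf_tail R a k <= 3.
Proof.
move=> da; have dk : digits12 (fun n => a (k + n)%N) by move=> j; exact: da.
have cv := is_cvg_finite_cf R _ dk.
apply/andP; split; [apply: limr_ge => //|apply: limr_le => //]; apply: nearW => n;
  by have /andP[] := finite_cf_bounds R _ n dk.
Qed.

Lemma infinite_cf_shift (R : realType) (a : nat -> nat) :
  digits12 a ->
  infinite_cf R a = (a 0%N)%:R + (infinite_cf R (fun n => a n.+1))^-1.
Proof.
move=> da; have d1 : digits12 (fun n => a n.+1) by move=> j; exact: da.
have /andP[lo _] := cf_tail_bounds R _ 0 d1.
apply/cvg_lim => //; rewrite -cvg_shiftS.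
rewrite (_ : [sequence _]_n =
  (fun n => (a 0%N)%:R + (finite_cf R (mkseq (fun n => a n.+1) n.+1))^-1)).
  apply: cvgD; first exact: cvg_cst.
  apply: cvgV; last exact: is_cvg_finite_cf.
  by apply/eqP => h; move: lo; rewrite /cf_tail h; lra.
by apply/funext => n; exact: finite_cf_shift.
Qed.

Lemma cf_tailS (R : realType) (a : nat -> nat) (k : nat) :
  digits12 a -> cf_tail R a k = (a k)%:R + (cf_tail R a k.+1)^-1.
Proof.
move=> da; rewrite /cf_tail infinite_cf_shift; last by move=> j; exact: da.
rewrite addn0; congr (_ + (infinite_cf R _)^-1).
by apply/funext => n; rewrite addnS.
Qed.

(** This is $x_k$, while [cf_tail] is $A_k$. At $k = 0$ no digit precedes, and the value 0 makes the
    form below equal to $(P - A_0 Q)P$. *)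
Fixpoint cf_back (R : realType) (a : nat -> nat) (k : nat) : R :=
  if k is j.+1 then ((a j)%:R + cf_back R a j)^-1 else 0.

Lemma cf_back_bounds (R : realType) (a : nat -> nat) (k : nat) :
  digits12 a -> 0 <= cf_back R a k <= 1.
Proof.
move=> da; elim: k => [|k /andP[lo hi]] /=; first by rewrite lexx ler01.
have /andP[? ?] := digits12_bounds R a k da.
by rewrite invr_ge0 invf_le1; [apply/andP; split; lra|lra].
Qed.

(* The indefinite form (P - A_k Q)(P + x_k Q) / (A_k + x_k) is invariant, up to
   sign, under one step of the Euclidean algorithm with quotient [a k], so a
   descent on P + Q reduces to the pairs with Q = 0 or P < a_k Q. *)
Lemma cf_form_lower_bound (R : realType) (a : nat -> nat) (M : R) (P Q k : nat) :
  digits12 a -> 2 <= M -> (forall j, cf_tail R a j + cf_back R a j <= M) ->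
  (0 < P)%N ->
  (cf_tail R a k + cf_back R a k) / M <=
  `|(P%:R - cf_tail R a k * Q%:R) * (P%:R + cf_back R a k * Q%:R)|.
Proof.
move=> da M2 HM; have M0 : 0 < M by lra.
have [s] := ubnP (P + Q)%N.
elim: s P Q k => // s IH P Q k PQs P0.
have /andP[x0 x1] := cf_back_bounds R a k da.
have /andP[A1 A3] := cf_tail_bounds R a k da.
have P1 : 1 <= P%:R :> R by rewrite ler1n.
case: (posnP Q) => [->|Q0].
  rewrite !mulr0 subr0 addr0 ger0_norm; last by nra.
  apply: (@le_trans _ _ 1); last by nra.
  by rewrite ler_pdivrMr// mul1r.
have /andP[d1 d2] := digits12_bounds R a k da.
have /andP[B1 B3] := cf_tail_bounds R a k.+1 da.
have AE := cf_tailS R a k da.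
have Q1 : 1 <= Q%:R :> R by rewrite ler1n.
set A := cf_tail R a k in A1 A3 AE *; set x := cf_back R a k in x0 x1 *.
set B := cf_tail R a k.+1 in B1 B3 AE.
have B0 : B != 0 by apply/eqP; lra.
(* Here the descent stops and both factors of the form are bounded directly. *)
have [ltP|leP] := ltnP P (a k * Q).
  have PQ : P%:R + 1 <= (a k)%:R * Q%:R :> R by rewrite -natrM natr1 ler_nat.
  have Bi : 0 < B^-1 by rewrite invr_gt0; lra.
  have l1 : 1 + B^-1 <= A * Q%:R - P%:R.
    have : B^-1 * 1 <= B^-1 * Q%:R by rewrite ler_pM2l.
    by rewrite AE; nra.
  have l2 : 1 + x <= P%:R + x * Q%:R by nra.
  rewrite -normrN -mulNr opprB ger0_norm; last by apply: mulr_ge0; lra.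
  rewrite ler_pdivrMr//.
  have l3 : (1 + B^-1) * (1 + x) <= (A * Q%:R - P%:R) * (P%:R + x * Q%:R).
    by apply: ler_pM; lra.
  (* Uses $A = d + 1/B$ with digit $d \le 2$; the factor 2 is then absorbed by $M \ge 2$. *)
  have l4 : A + x <= (1 + B^-1) * (1 + x) * 2 by rewrite AE; nra.
  apply: (le_trans l4); apply: ler_pM => //.
  by apply: mulr_ge0; lra.
(* Euclidean step: $(P, Q)$ at index $k$ becomes $(Q, Q')$ at index $k+1$, with a smaller sum. *)
have [Q' PE] : exists Q', P = (a k * Q + Q')%N.
  by exists (P - a k * Q)%N; rewrite subnKC.
have ak : (0 < a k)%N by case/orP: (da k) => /eqP ->.
have sQ : (Q + Q' < s)%N.
  have : (0 < a k * Q)%N by rewrite muln_gt0 ak.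
  by move: PQs; rewrite PE; clear; lia.
have := IH Q Q' k.+1 sQ Q0.
rewrite /= -/B -/x => IHQ.
set d : R := (a k)%:R in d1 d2 AE IHQ.
have dx0 : 0 < d + x by lra.
have dxn : d + x != 0 by apply/eqP; lra.
rewrite PE natrD natrM -/d.
(* Since $A = d + 1/B$ and the next backward value is $1/(d + x)$, the form and the sum $A + x$
   acquire the same factor $(d + x)/B$ up to sign. *)
have -> : (d * Q%:R + Q'%:R - A * Q%:R) * (d * Q%:R + Q'%:R + x * Q%:R) =
   - ((Q%:R - B * Q'%:R) * (Q%:R + (d + x)^-1 * Q'%:R)) * ((d + x) / B).
  by rewrite AE; field; rewrite B0 dxn.
have -> : (A + x) / M = (B + (d + x)^-1) / M * ((d + x) / B).
  by rewrite AE; field; rewrite B0 dxn gt_eqF.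
have c0 : 0 < (d + x) / B by rewrite divr_gt0//; lra.
by rewrite normrM normrN (gtr0_norm c0) ler_pM2r.
Qed.

(* [lagrange] alone would denote the interpolation polynomials of MathComp. *)
Lemma lagrange_le (R : realType) (a : nat -> nat) (c : nat) (M : R) :
  digits12 a -> 2 <= M -> (forall j, cf_tail R a j + cf_back R a j <= M) ->
  (Defs.lagrange (c%:R + (cf_tail R a 0)^-1)%R <= M%:E)%E.
Proof.
move=> da M2 HM; apply/ge_ereal_sup => _ [L /= infL <-]; rewrite lee_fin.
have M0 : 0 < M by lra.
have [L0|L0] := leP L 0; first by lra.
(* One rational is enough, because the lower bound on the distance holds for all of them. *)
have [r /= rL] : [set r : rat |
      `|ratr r - (c%:R + (cf_tail R a 0)^-1)| < 1 / (L * (denq r)%:~R ^+ 2)] !=set0.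
  by apply: infinite_setN0.
have /andP[A1 A3] := cf_tail_bounds R a 0 da.
set A := cf_tail R a 0 in A1 A3 rL.
have A0 : A != 0 by apply/eqP; lra.
have [q q0 qE] : exists2 q : nat, (0 < q)%N & denq r = q.
  by exists `|denq r|%N; rewrite ?absz_gt0 ?denq_neq0// absz_denq.
pose p : int := (numq r - c%:Z * q%:Z)%R.
have q0R : 0 < q%:R :> R by rewrite ltr0n.
have q1R : 1 <= q%:R :> R by rewrite ler1n.
have qn : q%:R != 0 :> R by apply/eqP; lra.
have rE : ratr r - (c%:R + A^-1) = (p%:~R - q%:R / A) / q%:R :> R.
  rewrite -[r in LHS]divq_num_den fmorph_div /= !ratr_int qE /p rmorphB rmorphM /=.
  by field; rewrite qn A0.
(* For $p \ge 0$ this is the form bound at index 0 for the pair $(q, p)$, divided by $A$. For $p <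
   0$ both terms have the same sign and the left factor is at least 1. *)
have key : 1 / M <= `|p%:~R - q%:R / A| * q%:R.
  have M1 : 1 / M <= 1 by rewrite ler_pdivrMr//; lra.
  case: (leP 0 p) => p0.
    have [n nE] : exists n : nat, p = n by exists `|p|%N; rewrite gez0_abs.
    have := cf_form_lower_bound R a M q n 0 da M2 HM q0.
    rewrite /= -/A nE mul0r !addr0 => h.
    have -> : 1 / M = A / M * A^-1 by field; rewrite A0 gt_eqF.
    have -> : `|n%:~R - q%:R / A| * q%:R = `|(q%:R - A * n%:R) * q%:R| * A^-1.
      have -> : n%:~R - q%:R / A = - (q%:R - A * n%:R) / A.
        by rewrite -pmulrn; field.
      by rewrite !normrM normrN normfV [`|A|]gtr0_norm ?[`|q%:R|]ger0_norm 1?mulrAC//; lra.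
    by rewrite ler_pM2r// invr_gt0; lra.
  have p1 : p%:~R <= -1 :> R by rewrite -[-1]/((-1)%:~R) ler_int; lia.
  have qA : 0 < q%:R / A by apply: divr_gt0; lra.
  apply: (le_trans M1); rewrite ler0_norm; last by lra.
  by rewrite -[leLHS]mulr1; apply: ler_pM; lra.
move: rL; rewrite qE rE normrM normfV (gtr0_norm q0R) => rL.
have : 1 / M < 1 / L.
  apply: (le_lt_trans key).
  have -> : 1 / L = 1 / (L * q%:R ^+ 2) * q%:R * q%:R by field; rewrite qn gt_eqF.
  by rewrite ltr_pM2r// -ltr_pdivrMr.
by rewrite !div1r ltf_pV2 ?posrE// => /ltW.
Qed.

(** * Convergents and the lower bound for the Lagrange value *)

Fixpoint continuants (a : nat -> nat) (s : nat * nat) (k : nat) : nat * nat :=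
  if k is j.+1 then
    let t := continuants a s j in ((a j * t.1 + t.2)%N, t.1)
  else s.

(** A pair holds the continuants of indices $k$ and $k-1$. With these seeds the first components
    give $p_k/q_k = [0; a_0, \ldots, a_{k-1}]$, a convergent of $1/A_0$. *)
Definition cf_num (a : nat -> nat) := continuants a (0, 1)%N.
Definition cf_den (a : nat -> nat) := continuants a (1, 0)%N.

Lemma cf_den_gt0 (a : nat -> nat) (k : nat) : digits12 a -> (0 < (cf_den a k).1)%N.
Proof.
move=> da; elim: k => // k IH /=.
by rewrite addn_gt0 muln_gt0 IH; case/orP: (da k) => /eqP ->.
Qed.

(** Unbounded denominators are what yields infinitely many distinct convergents. *)
Lemma leq_cf_den (a : nat -> nat) (k : nat) : digits12 a -> (k <= (cf_den a k).1)%N.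
Proof.
move=> da; case: k => // k; elim: k => [|k IH]; first exact: cf_den_gt0.
apply: (leq_trans (n := (cf_den a k.+1).1 + (cf_den a k).1)%N).
  by rewrite -addn1 leq_add// cf_den_gt0.
rewrite -/(cf_den a k) leq_add2r -[X in (X <= _)%N]mul1n leq_mul//.
by case/orP: (da k.+1) => /eqP ->.
Qed.

(** Dividing $q_{k+1} = a_k q_k + q_{k-1}$ by $q_k$ gives the recursion of [cf_back]. *)
Lemma cf_backE (R : realType) (a : nat -> nat) (k : nat) :
  digits12 a -> cf_back R a k = (cf_den a k).2%:R / (cf_den a k).1%:R.
Proof.
move=> da; elim: k => [|k IH]; first by rewrite /= mul0r.
have q0 := cf_den_gt0 a k da; have q1 := cf_den_gt0 a k.+1 da.
have qn : (cf_den a k).1%:R != 0 :> R by rewrite pnatr_eq0 -lt0n.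
have qn' : (cf_den a k.+1).1%:R != 0 :> R by rewrite pnatr_eq0 -lt0n.
move: qn'; rewrite /= -/(cf_den a k) IH natrD natrM => qn'.
by rewrite -[RHS]invf_div; congr (_ ^-1); field.
Qed.

Lemma cf_num_den_det (a : nat -> nat) (k : nat) :
  (cf_num a k).1%:Z * (cf_den a k).2%:Z - (cf_num a k).2%:Z * (cf_den a k).1%:Z
  = (-1) ^+ k.+1.
Proof.
elim: k => [|k IH]; first by [].
rewrite exprS -IH /= -/(cf_num a k) -/(cf_den a k) !PoszD !PoszM; ring.
Qed.

(** The Möbius relation between $1/A_0$ and $A_k$, cleared of denominators. Replacing $A_k$ by $a_k
    + 1/A_{k+1}$ and multiplying by $A_{k+1}$ gives the induction step. *)
Lemma cf_num_den_tail (R : realType) (a : nat -> nat) (k : nat) :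
  digits12 a ->
  (cf_num a k).1%:R * cf_tail R a k + (cf_num a k).2%:R =
  (cf_tail R a 0)^-1 * ((cf_den a k).1%:R * cf_tail R a k + (cf_den a k).2%:R).
Proof.
move=> da; have A0 j : cf_tail R a j != 0.
  by have /andP[? _] := cf_tail_bounds R a j da; apply/eqP; lra.
elim: k => [|k]; first by rewrite /= mul0r add0r mul1r addr0 mulVf.
rewrite [in X in X -> _](cf_tailS R a k da) /= -/(cf_num a k) -/(cf_den a k).
have := A0 k.+1; have := A0 0%N.
set B := cf_tail R a k.+1; set A := cf_tail R a 0 => An Bn IH.
rewrite !natrD !natrM.
have -> (x y : R) : ((a k)%:R * x + y) * B + x = B * (x * ((a k)%:R + B^-1) + y).
  by field.
by rewrite IH; field; rewrite Bn An.
Qed.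

(** In the difference of $p/q$ and $(pA + p')/(qA + q')$ the numerator is the determinant $\pm 1$,
    and $q(qA + q') = (A + q'/q) q^2$. *)
Lemma cf_convergent_dist (R : realType) (a : nat -> nat) (k : nat) :
  digits12 a ->
  `|(cf_num a k).1%:R / (cf_den a k).1%:R - (cf_tail R a 0)^-1| =
  1 / ((cf_tail R a k + cf_back R a k) * (cf_den a k).1%:R ^+ 2).
Proof.
move=> da; have /andP[A1 _] := cf_tail_bounds R a k da.
have q0 : 0 < (cf_den a k).1%:R :> R by rewrite ltr0n cf_den_gt0.
have r0 : 0 <= (cf_den a k).2%:R :> R by rewrite ler0n.
have := cf_num_den_tail R a k da.
have := congr1 (fun z : int => z%:~R : R) (cf_num_den_det a k).
rewrite cf_backE// rmorphB !rmorphM rmorphXn /= rmorphN1.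
rewrite -!pmulrn.
move: (cf_num a k).1%:R (cf_num a k).2%:R => p p'.
move: (cf_den a k).1%:R (cf_den a k).2%:R q0 r0 => q q' q0 r0.
move: (cf_tail R a k) (cf_tail R a 0)^-1 A1 => A y A1 det yE.
have qA : 0 < q * A + q' by nra.
have -> : y = (p * A + p') / (q * A + q') by rewrite yE mulfK// gt_eqF.
have -> : p / q - (p * A + p') / (q * A + q') = (-1) ^+ k.+1 / (q * (q * A + q')).
  by rewrite -det; field; rewrite !gt_eqF.
rewrite normrM normrX normrN1 expr1n normfV gtr0_norm; last exact: mulr_gt0.
by congr (1 / _); field; rewrite gt_eqF.
Qed.

Lemma lagrange_ge (R : realType) (a : nat -> nat) (c : nat) (L : R) :
  digits12 a -> 0 < L ->
  (forall N, exists2 k, (N <= k)%N & L < cf_tail R a k + cf_back R a k) ->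
  (L%:E <= Defs.lagrange (c%:R + (cf_tail R a 0)^-1)%R)%E.
Proof.
move=> da L0 HL; apply: ereal_sup_ubound; exists L => //= /finite_seqP[s sE].
(* If only finitely many rationals qualified, this index would exceed all their denominators, and
   $q_k \ge k$. *)
have [k Nk Lk] := HL (\max_(r <- s) `|denq r|).+1%N.
pose p := (cf_num a k).1; pose q := (cf_den a k).1.
have q0 : (0 < q)%N by exact: cf_den_gt0.
have q0R : 0 < q%:R :> R by rewrite ltr0n.
pose n : int := c%:Z * q%:Z + p%:Z.
pose r : rat := n%:~R / q%:Z%:~R.
(* The determinant supplies the Bezout coefficients; hence $q$ really is the reduced denominator. *)
have cop : coprimez n q.
  have := cf_num_den_det a k; rewrite -/p -/q => det.
  apply/coprimezP; exists ((-1) ^+ k.+1 * (cf_den a k).2%:Z,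
    - (-1) ^+ k.+1 * ((cf_num a k).2%:Z + c%:Z * (cf_den a k).2%:Z)).
  transitivity ((-1) ^+ k.+1 * ((-1) ^+ k.+1 : int)).
    by rewrite -[in X in _ = _ * X]det /n /=; ring.
  by rewrite -exprD addnn -mul2n exprM expr1n.
have den_r : denq r = q.
  by rewrite /r coprimeq_den// eqz_nat gtn_eqF.
have : r \in s.
  suff : [set` s] r by [].
  rewrite -sE /= den_r -pmulrn.
  have -> : ratr r = c%:R + p%:R / q%:R :> R.
    rewrite /r fmorph_div /= !ratr_int /n rmorphD rmorphM /= -!pmulrn.
    by field; rewrite gt_eqF.
  rewrite opprD addrACA subrr add0r cf_convergent_dist// -/q !div1r.
  have q2 : 0 < q%:R ^+ 2 :> R by rewrite exprn_gt0.
  by rewrite ltf_pV2 ?posrE ?ltr_pM2r// mulr_gt0//; lra.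
move=> rs; have : (`|denq r| <= \max_(t <- s) `|denq t|)%N.
  exact: (leq_bigmax_seq (P := xpredT)).
rewrite den_r absz_nat => qm.
by have := leq_trans (leq_trans Nk (leq_cf_den a k da)) qm; rewrite ltnn.
Qed.

(** * The contraction with fixed point $g$ *)

Definition golden_conj (R : realType) : R := (Num.sqrt 5 - 1) / 2.

Lemma golden_conj_bounds (R : realType) :
  1 / 2 <= golden_conj R /\ golden_conj R <= 1.
Proof.
have s0 : 0 <= Num.sqrt 5 :> R by exact: sqrtr_ge0.
have ss : Num.sqrt 5 ^+ 2 = 5 :> R by rewrite sqr_sqrtr//; lra.
by rewrite /golden_conj; split; nra.
Qed.

Lemma golden_conj_sqr (R : realType) : golden_conj R ^+ 2 = 1 - golden_conj R.
Proof.
have ss : Num.sqrt 5 ^+ 2 = 5 :> R by rewrite sqr_sqrtr//; lra.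
rewrite /golden_conj; move: (Num.sqrt 5) ss => s ss.
have -> : ((s - 1) / 2) ^+ 2 = (s ^+ 2 - 2 * s + 1) / 4 by field.
by rewrite ss; lra.
Qed.

(** The map is $x \mapsto (1 + x)/(2 + x)$, which fixes $g$ because $g^2 = 1 - g$. For $x \ge 0$ the
    denominator on the right is at least 4, whence the factor 1/4 in the next two lemmas. *)
Lemma double_one_dist (R : realType) (x : R) :
  0 <= x ->
  (1 + (1 + x)^-1)^-1 - golden_conj R =
  (x - golden_conj R) / ((2 + x) * (2 + golden_conj R)).
Proof.
move=> x0; have [g1 g2] := golden_conj_bounds R.
have gg := golden_conj_sqr R.
move: (golden_conj R) g1 g2 gg => g g1 g2 gg.
have -> : (1 + (1 + x)^-1)^-1 = (1 + x) / (2 + x) by field; apply/andP; split; apply/eqP; lra.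
have [n1 n2] : 2 + x != 0 /\ 2 + g != 0 by split; apply/eqP; lra.
have : ((1 + x) - g * (2 + x)) * (2 + g) = x - g - (2 + x) * (g ^+ 2 - (1 - g)).
  by ring.
rewrite gg subrr mulr0 subr0 => <-.
by field; rewrite n1 n2.
Qed.

Lemma double_one_le (R : realType) (x : R) (e : R) :
  0 <= x -> 0 <= e -> x <= golden_conj R + e ->
  (1 + (1 + x)^-1)^-1 <= golden_conj R + e / 4.
Proof.
move=> x0 e0 xe; have [g1 g2] := golden_conj_bounds R.
have := double_one_dist R x x0.
suff : (x - golden_conj R) / ((2 + x) * (2 + golden_conj R)) <= e / 4 by lra.
have d4 : 4 <= (2 + x) * (2 + golden_conj R) by nra.
rewrite ler_pdivrMr; last by lra.
by nra.
Qed.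

Lemma double_one_ge (R : realType) (x : R) (e : R) :
  0 <= x -> 0 <= e -> golden_conj R - e <= x ->
  golden_conj R - e / 4 <= (1 + (1 + x)^-1)^-1.
Proof.
move=> x0 e0 xe; have [g1 g2] := golden_conj_bounds R.
have := double_one_dist R x x0.
suff : - (e / 4) <= (x - golden_conj R) / ((2 + x) * (2 + golden_conj R)) by lra.
have d4 : 4 <= (2 + x) * (2 + golden_conj R) by nra.
rewrite ler_pdivlMr; last by lra.
by nra.
Qed.

(** Turns the contraction by 1/4 into an error term $1/(n+1)$, ready for the Archimedean
    property. *)
Lemma quarter_inv_succ (R : realType) (n : nat) :
  n.+1%:R^-1 / 4 <= n.+2%:R^-1 :> R.
Proof.
rewrite -invfM lef_pV2 ?posrE ?mulr_gt0 ?ltr0n//.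
by rewrite -natrM ler_nat; lia.
Qed.

(** * Bounds from even runs of 1's and from long runs of 1's *)

Lemma cf_tailV (R : realType) (a : nat -> nat) (k : nat) :
  digits12 a ->
  (cf_tail R a k)^-1 = ((a k)%:R + (cf_tail R a k.+1)^-1)^-1.
Proof. by move=> da; rewrite (cf_tailS R a k da). Qed.

(* The witness [b k] is the parity of the number of 1's among the first [k]
   digits: every 2 is preceded by an even number of 1's. *)
Definition even_runs (a : nat -> nat) (b : nat -> bool) :=
  [/\ b 0%N, forall k, b k.+1 = b k (+) (a k == 1%N) & forall k, a k = 2%N -> b k].

(** A digit 2 gives at most $1/2 \le g$. A digit 1 is followed by another 1 by parity, so the
    contraction applies to the tail two places on. As a run may be infinite, the bound is proved
    with error $1/(n+1)$ for every $n$. *)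
Lemma even_runs_tail_le (R : realType) (a : nat -> nat) (b : nat -> bool) (k : nat) :
  digits12 a -> even_runs a b -> b k -> (cf_tail R a k)^-1 <= golden_conj R.
Proof.
move=> da [_ bS b2] bk; have [g1 g2] := golden_conj_bounds R.
have inv01 j : 0 <= (cf_tail R a j)^-1 <= 1.
  have /andP[? _] := cf_tail_bounds R a j da.
  by rewrite invr_ge0 invf_le1; [apply/andP; split; lra|lra].
suff H n : (cf_tail R a k)^-1 <= golden_conj R + n.+1%:R^-1.
  rewrite leNgt; apply/negP => /ltr_add_invr[n]; apply/negP; rewrite -leNgt; exact: H.
elim: n k bk => [|n IH] k bk.
  by have /andP[_ ?] := inv01 k; rewrite invr1; lra.
rewrite cf_tailV//; case/orP: (da k) => /eqP ak; last first.
  have /andP[? _] := inv01 k.+1.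
  apply: (@le_trans _ _ (2^-1)); last by rewrite ler_wpDr ?invr_ge0//; lra.
  by rewrite ak lef_pV2 ?posrE; lra.
have bk1 : ~~ b k.+1 by rewrite bS bk ak.
have ak1 : a k.+1 = 1%N.
  by case/orP: (da k.+1) => /eqP// /b2 h; rewrite h in bk1.
have bk2 : b k.+2 by rewrite bS (negPf bk1) ak1.
rewrite ak cf_tailV// ak1.
have /andP[? _] := inv01 k.+2.
apply: le_trans (double_one_le _ _ _ _ _ (IH _ bk2)) _ => //.
by rewrite lerD2l quarter_inv_succ.
Qed.

(** The same alternative read backwards. The fraction is finite and starts from 0, so the induction
    needs no error term. *)
Lemma even_runs_back_le (R : realType) (a : nat -> nat) (b : nat -> bool) (k : nat) :
  digits12 a -> even_runs a b -> b k -> cf_back R a k <= golden_conj R.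
Proof.
move=> da [b0 bS b2]; have [g1 g2] := golden_conj_bounds R.
elim/ltn_ind: k => -[|k] IH bk; first by rewrite /=; lra.
have /andP[x0 _] := cf_back_bounds R a k da.
rewrite /=; case/orP: (da k) => /eqP ak; last first.
  apply: (@le_trans _ _ (2^-1)); last by lra.
  by rewrite ak lef_pV2 ?posrE; lra.
have nbk : ~~ b k by move: bk; rewrite bS ak eqxx addbT.
case: k ak nbk x0 IH {bk} => [|k] ak nbk _ IH; first by rewrite b0 in nbk.
have ak1 : a k = 1%N.
  by case/orP: (da k) => /eqP// a2; move: nbk; rewrite bS a2 b2.
have bk : b k by move: nbk; rewrite bS ak1 eqxx addbT negbK.
have /andP[x0 _] := cf_back_bounds R a k da.
rewrite /= ak ak1.
have := double_one_le R (cf_back R a k) 0 x0 (lexx 0).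
by rewrite mul0r !addr0; apply; apply: IH.
Qed.

(** At a digit 1 the crude bound $1 + 1 + 1 = 3$ suffices, as $g \ge 1/2$. At a digit 2 the parity
    is even at both $k$ and $k+1$, so both neighbours are at most $g$. *)
Lemma even_runs_tail_back_le (R : realType) (a : nat -> nat) (b : nat -> bool) (k : nat) :
  digits12 a -> even_runs a b ->
  cf_tail R a k + cf_back R a k <= 2 + 2 * golden_conj R.
Proof.
move=> da eb; have [g1 g2] := golden_conj_bounds R.
rewrite cf_tailS//; case/orP: (da k) => /eqP ak.
  have /andP[_ x1] := cf_back_bounds R a k da.
  have /andP[A1 _] := cf_tail_bounds R a k.+1 da.
  have : (cf_tail R a k.+1)^-1 <= 1 by rewrite invf_le1; lra.
  by rewrite ak; lra.
have bk : b k by case: eb => _ _; apply.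
have bk1 : b k.+1 by case: eb => _ -> _; rewrite ak addbF.
have := even_runs_tail_le R a b _ da eb bk1.
have := even_runs_back_le R a b _ da eb bk.
by rewrite ak; lra.
Qed.

(** Each pair of 1's is one application of the contraction, starting from error 1, which is valid
    since $g \le 1$. *)
Lemma ones_tail_ge (R : realType) (a : nat -> nat) (k n : nat) :
  digits12 a -> (forall j, (j < n.*2)%N -> a (k + j)%N = 1%N) ->
  golden_conj R - n.+1%:R^-1 <= (cf_tail R a k)^-1.
Proof.
move=> da; have [g1 g2] := golden_conj_bounds R.
have inv0 j : 0 <= (cf_tail R a j)^-1.
  by have /andP[? _] := cf_tail_bounds R a j da; rewrite invr_ge0; lra.
elim: n k => [|n IH] k a1; first by rewrite invr1; have := inv0 k; lra.
have ak : a k = 1%N by rewrite -[k]addn0 a1.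
have ak1 : a k.+1 = 1%N by rewrite -[k.+1]addn1 a1.
rewrite cf_tailV// cf_tailV// ak ak1.
apply: le_trans (double_one_ge _ _ _ (inv0 _) _ (IH _ _)).
- by rewrite lerD2l lerN2 quarter_inv_succ.
- by rewrite invr_ge0.
- by move=> j jn; rewrite !addSnnS a1// doubleS.
Qed.

Lemma ones_back_ge (R : realType) (a : nat -> nat) (k n : nat) :
  digits12 a -> (forall j, (j < n.*2)%N -> a (k + j)%N = 1%N) ->
  golden_conj R - n.+1%:R^-1 <= cf_back R a (k + n.*2).
Proof.
move=> da; have [g1 g2] := golden_conj_bounds R.
have back0 j : 0 <= cf_back R a j by have /andP[] := cf_back_bounds R a j da.
elim: n => [|n IH] a1; first by rewrite invr1; have := back0 (k + 0.*2)%N; lra.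
have a2 : a (k + n.*2)%N = 1%N by rewrite a1// doubleS.
have a3 : a (k + n.*2).+1 = 1%N by rewrite -addnS a1// doubleS.
rewrite doubleS !addnS /= a2 a3.
apply: le_trans (double_one_ge _ _ _ (back0 _) _ (IH _)).
- by rewrite lerD2l lerN2 quarter_inv_succ.
- by rewrite invr_ge0.
- by move=> j jn; rewrite a1// doubleS; lia.
Qed.

(** * Periods coming from words *)

Definition even_runs_seq (s : seq nat) :=
  [/\ all (fun d => (d == 1%N) || (d == 2%N)) s, ~~ odd (count_mem 1%N s)
    & forall i, nth 0%N s i = 2%N -> ~~ odd (count_mem 1%N (take i s))].

Lemma even_runs_seq_cons2 (s : seq nat) :
  even_runs_seq s -> even_runs_seq (2%N :: s).
Proof. by case=> s12 ev run; split=> // -[|i] //= /run. Qed.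

Lemma even_runs_seq_cons11 (s : seq nat) :
  even_runs_seq s -> even_runs_seq [:: 1%N, 1%N & s].
Proof.
case=> s12 ev run; split=> //=; first by rewrite negbK.
by case=> [|[|i]] //= /run; rewrite /= negbK.
Qed.

Lemma even_runs_word_cf (w : seq step) : even_runs_seq (word_cf w).
Proof.
have nil_ok : even_runs_seq [::] by split=> // i; rewrite nth_nil.
elim: w => // x [|y w] // IH /=.
by case: (x == y); [exact: even_runs_seq_cons11|exact: even_runs_seq_cons2].
Qed.

(** The shift by one splits off the leading digit 2, which becomes the integer part $c$ in the
    Lagrange bounds. *)
Definition periodic_tail (p : seq nat) (k : nat) : nat :=
  nth 0%N p (k.+1 %% size p).

(** The count restarts in each period; this keeps the parity because a period contains an even
    number of 1's. *)
Definition period_parity (p : seq nat) (k : nat) : bool :=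
  ~~ odd (count_mem 1%N (take (k.+1 %% size p) p)).

Lemma digits12_periodic_tail (s : seq nat) :
  even_runs_seq s -> digits12 (periodic_tail (2%N :: s)).
Proof.
move=> /even_runs_seq_cons2[/(all_nthP 0%N) p12 _ _] k.
by apply: p12; rewrite ltn_mod.
Qed.

Lemma even_runs_periodic_tail (s : seq nat) :
  even_runs_seq s ->
  even_runs (periodic_tail (2%N :: s)) (period_parity (2%N :: s)).
Proof.
move=> /even_runs_seq_cons2; set p := 2%N :: s => -[p12 ev run].
have p0 : (0 < size p)%N by [].
split=> [|k|k]; last exact: run.
  rewrite /period_parity /p /=; case: (size s) => [|m]; first by rewrite modn1.
  by rewrite modn_small//= take0.
rewrite /period_parity /periodic_tail.
have jN : (k.+1 %% size p < size p)%N by rewrite ltn_mod.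
have tk : count_mem 1%N (take (k.+1 %% size p).+1 p) =
    (count_mem 1%N (take (k.+1 %% size p) p) + (nth 0%N p (k.+1 %% size p) == 1%N))%N.
  by rewrite (take_nth 0%N)// -cats1 count_cat /= addn0.
have -> : ~~ odd (count_mem 1%N (take (k.+2 %% size p) p)) =
          ~~ odd (count_mem 1%N (take (k.+1 %% size p).+1 p)).
  (* At the wrap-around one side counts nothing and the other a whole period, both even. *)
  rewrite modnS; case: ifP => // dk.
  have -> : (k.+1 %% size p).+1 = size p.
    apply/eqP; rewrite eqn_leq jN /= dvdn_leq//.
    by rewrite /dvdn -[X in (X %% _)%N]addn1 modnDml addn1.
  by rewrite take0 take_size (negPf ev).
by rewrite tk oddD oddb addNb.
Qed.

Lemma path_cfE (R : realType) (w : seq step) :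
  path_cf R w =
  2%:R + (cf_tail R (periodic_tail (2%N :: word_cf w)) 0)^-1.
Proof.
rewrite /path_cf /periodic_cf infinite_cf_shift ?mod0n// => -[|k].
  by rewrite mod0n.
exact: digits12_periodic_tail (even_runs_word_cf w) k.
Qed.

(** A run of $m + 1$ equal letters has $m$ equal adjacent pairs, each contributing two 1's. *)
Lemma word_cf_nseq_cat (x : step) (m : nat) (w : seq step) :
  word_cf (nseq m.+1 x ++ w) = nseq m.*2 1%N ++ word_cf (x :: w).
Proof.
elim: m => // m IH; rewrite doubleS.
rewrite -[LHS]/((if x == x then [:: 1%N; 1%N] else [:: 2%N]) ++ word_cf (nseq m.+1 x ++ w)).
by rewrite eqxx IH.
Qed.

(** * The extremal paths *)

Definition hook (n : nat) : seq step := nseq n.+2 StepR ++ nseq n.+1 StepU.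

Lemma word_cf_hook (n : nat) :
  word_cf (hook n) = nseq n.+1.*2 1%N ++ 2%N :: nseq n.*2 1%N.
Proof.
have <- : word_cf (nseq n.+1 StepU) = nseq n.*2 1%N.
  by rewrite -[nseq n.+1 _]cats0 word_cf_nseq_cat cats0.
by rewrite /hook word_cf_nseq_cat.
Qed.

(** During the R's the height is 0; afterwards the abscissa is $a$, so the line is at height $b$,
    the total number of U's. *)
Lemma hook_all_paths (n : nat) : all_paths (hook n).
Proof.
exists (n.+2, n.+1) => /=; first by split=> //; rewrite coprimeSn.
split=> [||k _].
- by rewrite /hook count_cat !count_nseq /= mul1n mul0n addn0.
- by rewrite /hook count_cat !count_nseq /= mul1n mul0n.
rewrite /hook take_cat size_nseq; case: ltnP => kn.
  by rewrite take_nseq ?(ltnW kn)// !count_nseq /= mul0n mulr_ge0.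
set t := take _ _.
rewrite !count_cat !count_nseq /= mul0n mul1n add0n.
have -> : count_mem StepR t = 0%N.
  apply/count_memPn/negP => /mem_take; rewrite mem_nseq; by case/andP.
rewrite addn0 mulfVK ?pnatr_eq0// ler_nat.
apply: leq_trans (count_size _ _) _.
by rewrite size_take size_nseq; case: ltnP => // /ltnW.
Qed.

(** The index is that of a leading 2 of a later period, preceded by $1^{2n}$ and followed by
    $1^{2n+2}$. *)
Lemma hook_tail_back (R : realType) (n N : nat) :
  exists2 k, (N <= k)%N &
    2 + 2 * (golden_conj R - n.+1%:R^-1) <=
    cf_tail R (periodic_tail (2%N :: word_cf (hook n))) k +
    cf_back R (periodic_tail (2%N :: word_cf (hook n))) k.
Proof.
set a := periodic_tail _.
have da : digits12 a := digits12_periodic_tail _ (even_runs_word_cf _).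
(* The length of the period $2\,1^{2n+2}\,2\,1^{2n}$. *)
pose T := (4 * n + 4)%N.
have aE k : a k = nth 0%N (2%N :: nseq n.+1.*2 1%N ++ 2%N :: nseq n.*2 1%N) (k.+1 %% T).
  rewrite /a /periodic_tail word_cf_hook; congr (nth _ _ (_ %% _)).
  by rewrite /= size_cat /= !size_nseq /T -!muln2; lia.
have a2 : a (N * T + T.-1)%N = 2%N.
  have TE : (N * T + T.-1).+1 = (N.+1 * T)%N by rewrite /T; lia.
  by rewrite aE TE modnMl.
exists (N * T + T.-1)%N.
  by rewrite (leq_trans (leq_pmulr N (_ : 0 < T)%N)) ?leq_addr// /T addn_gt0 orbT.
have := ones_tail_ge R a (N * T + T.-1).+1 n da.
have := ones_back_ge R a (N * T + T.-1 - n.*2) n da.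
rewrite subnK; last by rewrite /T -muln2; lia.
move=> h1 h2; rewrite cf_tailS// a2.
have /h1 : forall j, (j < n.*2)%N -> a (N * T + T.-1 - n.*2 + j)%N = 1%N.
  move=> j jn; rewrite aE.
  (* The last run of the period starts after $2\,1^{2n+2}\,2$, that is at position $2n + 4$. *)
  have -> : (N * T + T.-1 - n.*2 + j).+1 = (N * T + (n.*2 + 4 + j))%N.
    by move: jn; rewrite /T -muln2; lia.
  rewrite modnMDl modn_small; last by move: jn; rewrite /T -muln2; lia.
  rewrite -[X in nth _ _ X]prednK; last by lia.
  rewrite -[LHS]/(nth 0%N (nseq n.+1.*2 1%N ++ 2%N :: nseq n.*2 1%N) _)
    nth_cat size_nseq ltnNge.
  have -> : (n.+1.*2 <= (n.*2 + 4 + j).-1)%N by rewrite -!muln2; lia.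
  have -> : ((n.*2 + 4 + j).-1 - n.+1.*2 = j.+1)%N by rewrite -!muln2; lia.
  by rewrite /= nth_nseq jn.
have /h2 : forall j, (j < n.*2)%N -> a ((N * T + T.-1).+1 + j)%N = 1%N.
  move=> j jn; rewrite aE.
  have -> : ((N * T + T.-1).+1 + j).+1 = (N.+1 * T + j.+1)%N by rewrite /T; lia.
  rewrite modnMDl modn_small; last by move: jn; rewrite /T -muln2; lia.
  have jn1 : (j < n.+1.*2)%N by rewrite doubleS; lia.
  by rewrite -[LHS]/(nth 0%N (nseq n.+1.*2 1%N ++ 2%N :: nseq n.*2 1%N) _)
    nth_cat size_nseq jn1 nth_nseq jn1.
move: (n.+1%:R^-1) => e; lra.
Qed.

(** * The supremum over all paths *)

Theorem theorem1p6 (R : realType) :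
  ereal_sup [set path_lagrange R w | w in all_paths] = (1 + Num.sqrt 5)%:E.
Proof.
have gE : 1 + Num.sqrt 5 = 2 + 2 * golden_conj R by rewrite /golden_conj; field.
have [g1 g2] := golden_conj_bounds R.
rewrite gE; apply/eqP; rewrite eq_le; apply/andP; split.
  apply/ge_ereal_sup => _ [w _ <-].
  rewrite /path_lagrange path_cfE.
  have ev := even_runs_word_cf w.
  apply: lagrange_le => [||j]; [exact: digits12_periodic_tail|lra|].
  exact: even_runs_tail_back_le (digits12_periodic_tail _ ev)
    (even_runs_periodic_tail _ ev).
apply/lee_addgt0Pr => e e0.
(* Halving pays for the errors on both sides of the digit 2; the minimum with 1 keeps $2 + 2g - d$
   positive, as [lagrange_ge] requires. *)
have [n] : exists n, 0 + n.+1%:R^-1 < Num.min e 1 / 2.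
  by apply: ltr_add_invr; rewrite divr_gt0// lt_min e0 ltr01.
rewrite add0r => ne.
have m1 : Num.min e 1 <= 1 by rewrite ge_min lexx orbT.
have me : Num.min e 1 <= e by rewrite ge_min lexx.
move: (Num.min e 1) ne m1 me => d nd d1 de.
rewrite -leeBlDr//.
apply: (@le_trans _ _ ((2 + 2 * golden_conj R - d)%:E)).
  by rewrite -EFinB lee_fin; lra.
apply: (@le_trans _ _ (path_lagrange R (hook n))); last first.
  by apply: ereal_sup_ubound; exists (hook n) => //; exact: hook_all_paths.
rewrite /path_lagrange path_cfE; apply: lagrange_ge.
- exact: digits12_periodic_tail (even_runs_word_cf _).
- lra.
- move=> N; have [k Nk kL] := hook_tail_back R n N.
  exists k => //; apply: lt_le_trans kL.
  by move: nd; move: (n.+1%:R^-1) => x nd; lra.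
Qed.
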